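(* Let $\mathcal{S}\subset\mathbb{R}^n$ be compact convex with $\|x\|\le D$ on $\mathcal{S}$ ($D\ge1$), and let $f_1,\dots,f_T:\mathcal{S}\to\mathbb{R}$ be differentiable and $\ell$-strongly convex with $\|\nabla f_t\|\le G$ on $\mathcal{S}$, and $T\ge2$. Let $\eta_i=\frac12\frac{\log T}{T\sqrt{2D}}2^{i-1}$, $N=\lceil\frac12\log_2(\frac{2DT^2}{\log^2T})\rceil+1$ and $\mathcal{H}=\{\gamma_i=1-\eta_i:i=1,\dots,N\}$, ordered $\gamma_1\ge\dots\ge\gamma_N$. For each $\gamma\in\mathcal{H}$ run a copy $A^\gamma$ of projected gradient descent: $\theta^\gamma_1\in\mathcal{S}$, $\theta^\gamma_{t+1}=\operatorname{argmin}_{\theta\in\mathcal{S}}\|\theta-(\theta^\gamma_t-\eta^\gamma_t\nabla f_t(\theta^\gamma_t))\|^2$ with $\eta^\gamma_t=\frac{1-\gamma}{\ell(1-\gamma^t)}$. Set $w_1^{\gamma_i}=\frac{C}{i(i+1)}$ with $C=1+1/|\mathcal{H}|$, play $\theta_t=\sum_{\gamma\in\mathcal{H}}w_t^\gamma\theta_t^\gamma$, and update $w_{t+1}^\gamma=\frac{w_t^\gamma\exp(-\lambda f_t(\theta_t^\gamma))}{\sum_{\mu\in\mathcal{H}}w_t^\mu\exp(-\lambda f_t(\theta_t^\mu))}$ with $\lambda=\ell/G^2$. Then for any comparator sequence $z_1,\dots,z_T\in\mathcal{S}$ with $\sum_{t=2}^T\|z_t-z_{t-1}\|\le V$, $$\sum_{t=1}^T\big(f_t(\theta_t)-f_t(z_t)\big)\le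 O(\max\{\log T,\sqrt{TV}\}).$$
   Context: $\ell$-strongly convex: $f(y)\ge f(x)+\nabla f(x)^\top(y-x)+\frac\ell2\|x-y\|^2$. $O(\cdot)$ hides constants depending only on $\ell,G,D$. *)

(* Defs.v *)
From HB Require Import structures.
From mathcomp Require Import all_boot all_order all_algebra.
From mathcomp Require Import all_classical all_reals all_analysis.
Set Implicit Arguments. Unset Strict Implicit. Unset Printing Implicit Defensive.
Import Order.TTheory GRing.Theory Num.Theory.
Import numFieldNormedType.Exports.
Local Open Scope classical_set_scope.
Local Open Scope ring_scope.

Section Defs.
Variables (R : realType) (n : nat).
Implicit Types (x y u v : 'rV[R]_n) (S : set 'rV[R]_n).

Definition dotv u v : R := \sum_(j < n) u 0 j * v 0 j.
Definition enorm u : R := Num.sqrt (dotv u u).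

Definition gradient_on S (f : 'rV[R]_n -> R) (g : 'rV[R]_n -> 'rV[R]_n) : Prop :=
  forall x, S x -> differentiable f x /\ forall h, 'd f x h = dotv (g x) h.

Definition strongly_convex_on S (l : R) (f : 'rV[R]_n -> R) (g : 'rV[R]_n -> 'rV[R]_n) :=
  forall x y, S x -> S y ->
    f x + dotv (g x) (y - x) + l / 2 * enorm (x - y) ^+ 2 <= f y.

Definition is_proj S y p : Prop :=
  S p /\ forall q, S q -> enorm (p - y) ^+ 2 <= enorm (q - y) ^+ 2.

Definition numH (D : R) (T : nat) : nat :=
  (`| Num.ceil (1/2 * (ln (2 * D * T%:R ^+ 2 / (ln T%:R) ^+ 2) / ln 2)) | + 1)%N.

Definition etaH (D : R) (T i : nat) : R :=
  1/2 * (ln T%:R / (T%:R * Num.sqrt (2 * D))) * 2 ^+ i.-1.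
Definition gammaH (D : R) (T i : nat) : R := 1 - etaH D T i.

Definition stepsize (l gam : R) (t : nat) : R := (1 - gam) / (l * (1 - gam ^+ t)).

(* exponentially weighted aggregation weights w_t^{gamma_i}, i = 1..N, t >= 1;
   theta i t is the iterate of copy A^{gamma_i} at round t. *)
Fixpoint weight (N : nat) (lam : R) (f : nat -> 'rV[R]_n -> R)
    (theta : nat -> nat -> 'rV[R]_n) (t i : nat) : R :=
  match t with
  | 0 => 0
  | 1 => (1 + 1 / N%:R) / (i * i.+1)%:R
  | t'.+1 =>
      weight N lam f theta t' i * expR (- lam * f t' (theta i t')) /
      \sum_(1 <= j < N.+1) weight N lam f theta t' j * expR (- lam * f t' (theta j t'))
  end.

Definition played (N : nat) (lam : R) f theta (t : nat) : 'rV[R]_n :=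
  \sum_(1 <= i < N.+1) weight N lam f theta t i *: theta i t.

End Defs.

(* Main.v *)
Require Import Defs.
From HB Require Import structures.
From mathcomp Require Import all_boot all_order all_algebra.
From mathcomp Require Import all_classical all_reals all_analysis.
From mathcomp Require Import ring lra.
Set Implicit Arguments. Unset Strict Implicit. Unset Printing Implicit Defensive.
Import Order.TTheory GRing.Theory Num.Theory.
Import numFieldNormedType.Exports.
Local Open Scope classical_set_scope.
Local Open Scope ring_scope.

(* For one copy of projected gradient descent, 1/eta_t - 1/eta_(t-1) =
   l gamma^(t-1) <= l, so strong convexity absorbs the increments of the inverse
   step sizes and telescoping gives, with eta = 1 - gamma and P the path length
   of the comparator, a regret of at most
     2 D l P / eta + G^2 / (2 l) * (1 + ln T + T eta),
   the last term by Bernoulli's bound (1 - eta)^t (1 + t eta) <= 1.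
   Since an l-strongly convex function with gradient bounded by G is
   l/G^2-exp-concave, exponential weights lose at most (G^2/l) ln (1/w_1^i) =
   O(ln T) against copy i.  With M = max (ln T, sqrt (T P)) the geometric grid
   contains an eta within a factor 2 of M / (2 T sqrt (2 D)), and for it both
   P / eta and T eta are O(M). *)

(** * Euclidean geometry: Cauchy-Schwarz, convex combinations and projections *)

Section Dot.
Context {R : realType} {n : nat}.
Implicit Types (u v w : 'rV[R]_n) (a : R).

Lemma dotvC u v : dotv u v = dotv v u.
Proof. by apply: eq_bigr => j _; rewrite mulrC. Qed.

Lemma dotvDl u v w : dotv (u + v) w = dotv u w + dotv v w.
Proof. by rewrite -big_split; apply: eq_bigr => j _; rewrite !mxE mulrDl. Qed.

Lemma dotvZl a u w : dotv (a *: u) w = a * dotv u w.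
Proof. by rewrite mulr_sumr; apply: eq_bigr => j _; rewrite !mxE mulrA. Qed.

Lemma dotvNl u w : dotv (- u) w = - dotv u w.
Proof. by rewrite -scaleN1r dotvZl mulN1r. Qed.

Lemma dotvDr w u v : dotv w (u + v) = dotv w u + dotv w v.
Proof. by rewrite dotvC dotvDl !(dotvC _ w). Qed.

Lemma dotvZr a w u : dotv w (a *: u) = a * dotv w u.
Proof. by rewrite dotvC dotvZl dotvC. Qed.

Lemma dotvNr w u : dotv w (- u) = - dotv w u.
Proof. by rewrite dotvC dotvNl dotvC. Qed.

Definition dotvE := (dotvDl, dotvDr, dotvNl, dotvNr, dotvZl, dotvZr).

Lemma dotv_sumr (I : Type) (r : seq I) (P : pred I) w (F : I -> 'rV[R]_n) :
  dotv w (\sum_(i <- r | P i) F i) = \sum_(i <- r | P i) dotv w (F i).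
Proof.
apply: (big_morph (dotv w) (dotvDr w)).
by rewrite /dotv big1 // => j _; rewrite mxE mulr0.
Qed.

Lemma dotvv_ge0 u : 0 <= dotv u u.
Proof. by apply: sumr_ge0 => j _; rewrite -expr2 sqr_ge0. Qed.

Lemma enorm_ge0 u : 0 <= enorm u. Proof. exact: sqrtr_ge0. Qed.

Lemma enorm_sqr u : enorm u ^+ 2 = dotv u u.
Proof. by rewrite sqr_sqrtr // dotvv_ge0. Qed.

Lemma enormN u : enorm (- u) = enorm u.
Proof. by rewrite /enorm dotvNl dotvNr opprK. Qed.

Lemma dotv_sqr_le u v : dotv u v ^+ 2 <= dotv u u * dotv v v.
Proof.
have q s : 0 <= dotv u u - 2 * s * dotv u v + s ^+ 2 * dotv v v.
  have := dotvv_ge0 (u - s *: v); rewrite !dotvE (dotvC v u).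
  by congr (_ <= _); ring.
have := dotvv_ge0 v; rewrite le_eqVlt => /orP[/eqP v0|v0].
  rewrite -v0 mulr0; have [->|uv0] := eqVneq (dotv u v) 0.
    by rewrite expr0n.
  (* When [v] has norm zero the quadratic is affine in [s]; this [s] gives it the value -1. *)
  have := q ((dotv u u + 1) / (2 * dotv u v)); rewrite -v0.
  have -> : 2 * ((dotv u u + 1) / (2 * dotv u v)) * dotv u v = dotv u u + 1.
    by field.
  lra.
have := q (dotv u v / dotv v v).
have -> : dotv u u - 2 * (dotv u v / dotv v v) * dotv u v +
    (dotv u v / dotv v v) ^+ 2 * dotv v v =
    (dotv u u * dotv v v - dotv u v ^+ 2) / dotv v v.
  by field; rewrite gt_eqF.
by rewrite pmulr_lge0 ?invr_gt0 // subr_ge0.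
Qed.

Lemma dotv_le u v : dotv u v <= enorm u * enorm v.
Proof.
rewrite (le_trans (ler_norm _)) // -(ler_pXn2r (ltn0Sn 1)) ?nnegrE //.
  by rewrite exprMn !enorm_sqr real_normK ?num_real ?dotv_sqr_le.
by rewrite mulr_ge0 ?enorm_ge0.
Qed.

Lemma enorm_sub_le u v D : enorm u <= D -> enorm v <= D ->
  enorm (u - v) <= 2 * D.
Proof.
move=> uD vD; have D0 := le_trans (enorm_ge0 u) uD.
rewrite -(ler_pXn2r (ltn0Sn 1)) ?nnegrE ?enorm_ge0 ?mulr_ge0 // enorm_sqr.
have := dotv_le (- u) v; rewrite enormN dotvNl.
have := enorm_sqr u; have := enorm_sqr v; rewrite !dotvE (dotvC v u).
have := enorm_ge0 u; have := enorm_ge0 v.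
by move: (enorm u) (enorm v) uD vD => a b; nra.
Qed.

(** Frees [convex_set] from its interval-typed parameter. *)
Lemma convex_setP (S : set 'rV[R]_n) : convex_set S ->
  forall x y t, S x -> S y -> 0 <= t <= 1 -> S (x + t *: (y - x)).
Proof.
move=> cS x y t Sx Sy /andP[t0 t1].
have ti : Itv.spec (@Itv.num_sem R) (Itv.Real `[0%Z, 1%Z]) t.
  by rewrite /= /Itv.num_sem /= num_real in_itv/= t0.
have := cS y x (Itv.mk ti); rewrite !inE => /(_ Sy Sx).
rewrite /conv /= => St; suff -> : x + t *: (y - x) =
  t *: y + (1 - t) *: x by exact: St.
by rewrite scalerBr scalerBl scale1r addrC -addrA [- _ + _]addrC.
Qed.

(** Dividing by the total weight lets the induction use only segments: the new barycentre lies
    between the new point and the old barycentre, at parameter W / (W + w_(N+1)). *)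
Lemma convex_set_sum (S : set 'rV[R]_n) (w : nat -> R) (x : nat -> 'rV[R]_n)
    (N : nat) :
  convex_set S -> (forall i, (1 <= i <= N)%N -> 0 < w i) ->
  (forall i, (1 <= i <= N)%N -> S (x i)) -> (0 < N)%N ->
  S ((\sum_(1 <= i < N.+1) w i)^-1 *: \sum_(1 <= i < N.+1) w i *: x i).
Proof.
move=> cS; elim: N => // N IH w0 Sx _.
have [->|N0] := posnP N.
  rewrite !big_nat1 scalerA mulVf ?scale1r; first exact: Sx.
  by rewrite gt_eqF // w0.
have lift i : (1 <= i <= N)%N -> (1 <= i <= N.+1)%N.
  by case/andP=> -> /leqW.
have {IH} := IH (fun i h => w0 _ (lift _ h)) (fun i h => Sx _ (lift _ h)) N0.
rewrite !(@big_nat_recr _ _ _ N.+1) //=.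
set W := \sum_(_ <= _ < _) _; set X := \sum_(_ <= _ < _) _ => SX.
have W0 : 0 <= W.
  rewrite /W big_nat_cond; apply: sumr_ge0 => i; rewrite andbT ltnS => /lift.
  by move/w0/ltW.
have wN : 0 < w N.+1 by rewrite w0 // leqnn.
have := convex_setP cS (Sx N.+1 _) SX (t := W / (W + w N.+1)).
rewrite leqnn => /(_ isT); rewrite divr_ge0 ?addr_ge0 ?(ltW wN) //=.
rewrite ler_pdivrMr ?ltr_wpDl // mul1r lerDl (ltW wN) => /(_ isT).
have [W00|W00] := eqVneq W 0.
  exfalso; move: W00; rewrite /W big_ltn //; apply/eqP.
  rewrite gt_eqF // ltr_wpDr ?w0 //= big_nat_cond; apply: sumr_ge0 => i.
  by rewrite andbT ltnS => /andP[i2 /(conj (ltnW i2))/andP/lift/w0/ltW].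
congr S; have S0 : W + w N.+1 != 0 by rewrite gt_eqF // ltr_wpDl.
apply/rowP => j; rewrite !mxE; field; exact/andP.
Qed.

(** Minimality of [p] along the segment to [q] gives the variational inequality (p - y).(q - p) >=
    0; the claim follows by expanding |y - q|^2 around [p]. *)
Lemma proj_contracts (S : set 'rV[R]_n) y p q : convex_set S ->
  is_proj S y p -> S q -> enorm (p - q) ^+ 2 <= enorm (y - q) ^+ 2.
Proof.
move=> cS [Sp pmin] Sq.
have var t : 0 < t <= 1 ->
    0 <= 2 * dotv (p - y) (q - p) + t * dotv (q - p) (q - p).
  move=> /andP[t0 t1]; rewrite -(pmulr_rge0 _ t0).
  have := pmin _ (convex_setP cS Sp Sq (t := t) _).
  rewrite (ltW t0) t1 => /(_ isT).
  rewrite addrAC !enorm_sqr; move: (p - y) (q - p) => a b.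
  rewrite !dotvE (dotvC b a); nra.
have d0 : 0 <= dotv (p - y) (q - p).
  rewrite leNgt; apply/negP => neg.
  set b := dotv (p - y) (q - p) in neg var; set c := dotv (q - p) _ in var.
  have c0 : 0 <= c by exact: dotvv_ge0.
  have cb : 0 < c - b by lra.
  (* This t lies in (0, 1] and satisfies t c <= -b, so 2 b + t c <= b < 0 contradicts [var]. *)
  have := var (- b / (c - b)).
  rewrite divr_gt0 ?oppr_gt0 // ler_pdivrMr // mul1r lerDr c0 => /(_ isT).
  suff : - b / (c - b) * c <= - b by lra.
  rewrite mulrAC ler_pdivrMr //; nra.
have -> : y - q = (p - q) - (p - y) by apply/rowP => j; rewrite !mxE; ring.
move: d0; rewrite -(opprB p q) !enorm_sqr; have := dotvv_ge0 (p - y).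
move: (p - q) (p - y) => a b; rewrite !dotvE (dotvC b a); lra.
Qed.

End Dot.

(** * Exp-concavity of strongly convex functions with bounded gradient *)

Section ExpConcave.
Context {R : realType}.

(* p and q are the slopes, at the two ends of a segment of length c, of an
   m-strongly convex function with end values a and b: the lemma says that
   expR (- lam * -) of that function has a smaller slope at the second end. *)
Lemma slope_expR_le (lam m c p q a b : R) : 0 <= lam -> 0 < c ->
  lam * p ^+ 2 <= m -> lam * q ^+ 2 <= m ->
  a + c * p + m / 2 * c ^+ 2 <= b -> b - c * q + m / 2 * c ^+ 2 <= a ->
  p * expR (- lam * a) <= q * expR (- lam * b).
Proof.
move=> lam0 c0 lp lq pab qab.
have m0 : 0 <= m by rewrite (le_trans _ lp) // mulr_ge0 // sqr_ge0.
have mc0 : 0 <= m / 2 * c ^+ 2 by rewrite mulr_ge0 ?sqr_ge0 // divr_ge0.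
have pq : p + m * c <= q by rewrite -(ler_pM2l c0); lra.
(* The bound 1 + x <= exp x must be multiplied by a slope of known sign: it is used with [q] when q
   >= 0, and with [p] otherwise, since then p <= q - m c < 0. *)
have [q0|q0] := leP 0 q.
  have -> : - lam * b = - lam * a + - lam * (b - a) by ring.
  rewrite expRD mulrCA mulrC ler_wpM2l ?expR_ge0 //.
  have := expR_ge1Dx (- lam * (b - a)); move: (expR _) => E hE.
  have h1 : lam * (b - a) <= lam * (c * q) by rewrite ler_wpM2l //; lra.
  have h2 : q * (1 - lam * (c * q)) <= q * E by rewrite ler_wpM2l //; lra.
  have h3 : c * (lam * q ^+ 2) <= c * m by rewrite ler_wpM2l // ltW.
  lra.
have -> : - lam * a = - lam * b + lam * (b - a) by ring.
rewrite expRD mulrCA [q * _]mulrC ler_wpM2l ?expR_ge0 //.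
have := expR_ge1Dx (lam * (b - a)); move: (expR _) => E hE.
have h1 : lam * (c * p) <= lam * (b - a) by rewrite ler_wpM2l //; lra.
have p0 : p < 0 by have := mulr_ge0 m0 (ltW c0); lra.
have h2 : p * E <= p * (1 + lam * (c * p)) by rewrite (ler_wnM2l (ltW p0)); lra.
have h3 : c * (lam * p ^+ 2) <= c * m by rewrite ler_wpM2l // ltW.
lra.
Qed.

Context {n : nat}.
Implicit Types (x y : 'rV[R]_n) (S : set 'rV[R]_n).

Lemma is_derive_line (f : 'rV[R]_n -> R) x d t :
  differentiable f (x + t *: d) ->
  is_derive t 1 (fun s => f (x + s *: d)) ('d f (x + t *: d) d).
Proof.
move=> df; have [dv <-] : derivable f (x + t *: d) d /\
    'D_d f (x + t *: d) = 'd f (x + t *: d) d.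
  by split; [exact: diff_derivable|exact: deriveE].
have E : (fun h : R => h^-1 *: (((fun s => f (x + s *: d)) \o shift t) (h *: 1)
      - f (x + t *: d))) =
    (fun h => h^-1 *: ((f \o shift (x + t *: d)) (h *: d) - f (x + t *: d))).
  apply/funext => h /=; congr (_ *: (f _ - _)).
  by rewrite scaler1 scalerDl addrCA.
apply: DeriveDef; first by rewrite /derivable E.
by rewrite /derive E.
Qed.

(** Concavity in tangent form, obtained from first derivatives alone: the mean value theorem on the
    segment from [x] to [y] yields a slope at some point c, and [slope_expR_le] compares it with the
    slope at [x]. *)
Lemma expR_tangent S (l G : R) (f : 'rV[R]_n -> R) g x y : 0 < l -> 0 < G ->
  convex_set S -> gradient_on S f g -> strongly_convex_on S l f g ->
  (forall u, S u -> enorm (g u) <= G) -> S x -> S y ->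
  expR (- (l / G ^+ 2) * f y) <=
  expR (- (l / G ^+ 2) * f x) * (1 - l / G ^+ 2 * dotv (g x) (y - x)).
Proof.
move=> l0 G0 cS gf sc gG Sx Sy; set lam := l / G ^+ 2; set d := y - x.
have lam0 : 0 < lam by rewrite divr_gt0 ?exprn_gt0.
have lamG : lam * G ^+ 2 = l by rewrite mulfVK // expf_neq0 ?gt_eqF.
have Sxd (t : R) : 0 <= t <= 1 -> S (x + t *: d) by exact: convex_setP.
pose h (t : R) : R := expR (- lam * f (x + t *: d)).
pose h' (t : R) : R := - lam * dotv (g (x + t *: d)) d * h t.
have dh (t : R) : 0 <= t <= 1 -> is_derive t 1 h (h' t).
  move=> /Sxd/gf[dft gt]; have := is_derive_line dft; rewrite gt => dl.
  have -> : h = expR \o (- lam \*: fun s => f (x + s *: d)) by [].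
  apply: is_derive_eq; rewrite /h' /h /=; rewrite -[_ *: _]/(_ * _).
  by rewrite mulrC.
(* By Cauchy-Schwarz and lam G^2 = l, slopes along [d] meet the hypothesis of [slope_expR_le] with m
   = l |d|^2. *)
have slope u : S u -> lam * dotv (g u) d ^+ 2 <= l * dotv d d.
  move=> Su; rewrite -lamG -mulrA (ler_wpM2l (ltW lam0)) //.
  rewrite (le_trans (dotv_sqr_le _ _)) // ler_wpM2r ?dotvv_ge0 //.
  by rewrite -enorm_sqr ler_pXn2r ?nnegrE ?enorm_ge0 ?(ltW G0) ?gG.
have [||c] := @MVT_segment R h h' 0 1 ler01.
- by move=> t /[!in_itv] /= /andP[/ltW ? /ltW ?]; apply: dh; apply/andP.
- apply: derivable_within_continuous => t; rewrite in_itv /= => t01.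
  by have [] := dh t t01.
rewrite in_itv /= => c01; rewrite subr0 mulr1 /h' /h scale1r scale0r addr0.
rewrite [x + d]addrC subrK => /(canRL (subrK _)) ->.
suff : dotv (g x) d * expR (- lam * f x) <=
    dotv (g (x + c *: d)) d * expR (- lam * f (x + c *: d)).
  by move=> /(ler_wpM2l (ltW lam0)); lra.
have [c0 c1] := andP c01; move: c0; rewrite le_eqVlt => /orP[/eqP <-|c0].
  by rewrite scale0r addr0.
have quad : l / 2 * enorm (c *: d) ^+ 2 = l * dotv d d / 2 * c ^+ 2.
  by rewrite enorm_sqr dotvZl dotvZr; ring.
have e1 : x + c *: d - x = c *: d by rewrite addrC addKr.
apply: (slope_expR_le (ltW lam0) c0 (slope _ Sx)).
- exact: slope (Sxd _ c01).
- have := sc _ _ Sx (Sxd _ c01).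
  by rewrite -[x - _]opprB enormN e1 dotvZr quad.
- have := sc _ _ (Sxd _ c01) Sx.
  by rewrite -[x - _]opprB e1 dotvNr dotvZr quad.
Qed.

End ExpConcave.

(** * Dynamic regret of one copy of projected gradient descent *)

Section GradientDescent.
Context {R : realType}.

(** Serves to show e / (1 - (1 - e)^t) <= 1/t + e, the bound on a single step size. *)
Lemma exprB1_le (e : R) k : 0 <= e <= 1 -> (1 - e) ^+ k * (1 + k%:R * e) <= 1.
Proof.
move=> /andP[e0 e1]; elim: k => [|k IH].
  by rewrite expr0 mul0r addr0 mulr1.
apply: le_trans IH; rewrite exprSr -mulrA ler_wpM2l ?exprn_ge0 ?subr_ge0 //.
rewrite -natr1; have := mulr_ge0 (ler0n R k) (mulr_ge0 e0 e0).
by have := mulr_ge0 e0 e0; lra.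
Qed.

(** Each new term 1/k is at most -ln (1 - 1/k) = ln k - ln (k - 1), which telescopes. *)
Lemma sum_inv_le (T : nat) :
  \sum_(1 <= t < T.+2) t%:R^-1 <= 1 + ln T.+1%:R :> R.
Proof.
elim: T => [|T IH]; first by rewrite big_nat1 invr1 ln1 addr0.
rewrite big_nat_recr //=; apply: le_trans (lerD IH (lexx _)) _.
have T0 : 0 < T.+2%:R :> R by rewrite ltr0n.
have : ln (1 + - T.+2%:R^-1 : R) <= - T.+2%:R^-1.
  by apply: le_ln1Dx; rewrite ltrN2 invf_lt1 // ltr1n.
have -> : 1 + - T.+2%:R^-1 = T.+1%:R / T.+2%:R :> R.
  by rewrite -[T.+1%:R](addrK 1) natr1 mulrBl divff ?gt_eqF // mul1r.
rewrite ln_div ?posrE ?ltr0n //.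
by move: (ln T.+1%:R) (ln T.+2%:R) (T.+2%:R^-1) => a b c; lra.
Qed.

Lemma sum_stepsize_le (l gam : R) (T : nat) : 0 < l -> 0 < gam < 1 ->
  \sum_(1 <= t < T.+2) stepsize l gam t <=
  (1 + ln T.+1%:R + T.+1%:R * (1 - gam)) / l.
Proof.
move=> l0 /andP[g0 g1].
have step t : (0 < t)%N -> stepsize l gam t <= (t%:R^-1 + (1 - gam)) / l.
  case: t => // t _; rewrite /stepsize; set e := 1 - gam.
  have e01 : 0 <= e <= 1 by rewrite /e; apply/andP; split; lra.
  have e0 : 0 < e by rewrite subr_gt0.
  have k0 : 0 < t.+1%:R :> R by rewrite ltr0n.
  have lt1 : gam ^+ t.+1 < 1 by rewrite exprn_ilt1 ?ltW.
  rewrite invfM mulrCA mulrC ler_wpM2r ?invr_ge0 ?(ltW l0) //.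
  rewrite ler_pdivrMr ?subr_gt0 //.
  have := exprB1_le t.+1 e01; rewrite subKr => B.
  have -> : (t.+1%:R^-1 + e) * (1 - gam ^+ t.+1) =
     e + t.+1%:R^-1 * (1 - gam ^+ t.+1 * (1 + t.+1%:R * e)).
    by field; rewrite gt_eqF.
  by rewrite lerDl mulr_ge0 ?subr_ge0 // invr_ge0.
apply: (@le_trans _ _ (\sum_(1 <= t < T.+2) (t%:R^-1 + (1 - gam)) / l)).
  rewrite big_nat_cond [leRHS]big_nat_cond; apply: ler_sum => t.
  by rewrite andbT => /andP[/step].
rewrite -mulr_suml big_split /= sumr_const_nat subn1 /= -[_ *+ _]mulr_natl.
by rewrite ler_wpM2r ?invr_ge0 ?(ltW l0) // lerD2r sum_inv_le.
Qed.

Context {n : nat}.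
Implicit Types (u v w : 'rV[R]_n).

(** Expansion of the square after one unprojected step of size [e]; [s] is the inverse step size. *)
Lemma gradient_step u v w (G s e : R) : 0 < s -> s * e = 1 -> enorm v <= G ->
  dotv v (u - w) + s / 2 * enorm (u - e *: v - w) ^+ 2 <=
  s / 2 * enorm (u - w) ^+ 2 + e * G ^+ 2 / 2.
Proof.
move=> s0 se vG; have G0 := le_trans (enorm_ge0 v) vG.
have e0 : 0 < e by rewrite -(pmulr_rgt0 _ s0) se.
have -> : u - e *: v - w = (u - w) - e *: v by rewrite addrAC.
rewrite !enorm_sqr; move: (u - w) => {}u; rewrite !dotvE (dotvC u v).
have v2 : dotv v v <= G ^+ 2.
  by rewrite -enorm_sqr ler_pXn2r ?nnegrE ?enorm_ge0.
have sK A : s * (e * A) = A by rewrite mulrA se mul1r.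
have := sK (dotv v u); have := sK (e * dotv v v).
have := ler_wpM2l (ltW e0) v2; lra.
Qed.

(** The price of moving the comparator from [v] to [w]: the squared distances differ by (w - v).(w +
    v - 2 u). *)
Lemma enorm_sqr_drift (D : R) u v w : enorm u <= D -> enorm v <= D ->
  enorm w <= D ->
  enorm (u - w) ^+ 2 <= enorm (u - v) ^+ 2 + 4 * D * enorm (w - v).
Proof.
move=> uD vD wD; set d := w - v.
have -> : u - w = u - v - d by rewrite opprB addrA subrK.
have dd : dotv d d = dotv w d - dotv v d by rewrite -dotvNl -dotvDl.
have h (x : 'rV[R]_n) : enorm x <= D -> dotv x d <= D * enorm d.
  by move=> xD; rewrite (le_trans (dotv_le _ _)) // ler_wpM2r ?enorm_ge0.
have uD' : enorm (- u) <= D by rewrite enormN.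
move: (h _ uD') (h _ vD) (h _ wD); rewrite !enorm_sqr dotvNl.
by clearbody d; rewrite !dotvE !(dotvC d) dd (dotvC v u); lra.
Qed.

Lemma descent_regret (S : set 'rV[R]_n) (l G D gam : R) (T : nat)
    (f : nat -> 'rV[R]_n -> R) g x z :
  0 < l -> 0 < gam < 1 -> convex_set S -> (forall u, S u -> enorm u <= D) ->
  (forall t, (1 <= t <= T.+1)%N -> strongly_convex_on S l (f t) (g t)) ->
  (forall t, (1 <= t <= T.+1)%N -> forall u, S u -> enorm (g t u) <= G) ->
  S (x 1) ->
  (forall t, (1 <= t < T.+1)%N ->
     is_proj S (x t - stepsize l gam t *: g t (x t)) (x t.+1)) ->
  (forall t, (1 <= t <= T.+1)%N -> S (z t)) ->
  \sum_(1 <= t < T.+2) (f t (x t) - f t (z t)) <=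
    2 * D * (l / (1 - gam)) * \sum_(2 <= t < T.+2) enorm (z t - z t.-1)
    + G ^+ 2 / 2 * \sum_(1 <= t < T.+2) stepsize l gam t.
Proof.
move=> l0 /andP[gam0 gam1] cS SD sc gG Sx1 xproj Sz.
have Sx t : (1 <= t <= T.+1)%N -> S (x t).
  by case: t => // -[_|t ht] //; have [] := xproj t.+1 ht.
(* The inverse step sizes; [s 0] is 0, so the initial distance to the comparator costs nothing. *)
pose s k := l * (1 - gam ^+ k) / (1 - gam).
have gk k : 0 < gam ^+ k <= 1 by rewrite exprn_gt0 // exprn_ile1 // ltW.
have L0 : 0 < l / (1 - gam) by rewrite divr_gt0 ?subr_gt0.
have sL k : s k <= l / (1 - gam).
  rewrite /s mulrAC -[leRHS]mulr1 ler_wpM2l ?(ltW L0) //.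
  by have := gk k; lra.
(* The increment is l gam^k <= l, which the quadratic term of strong convexity pays for. *)
have sS k : s k.+1 - l <= s k.
  have -> : s k.+1 - l = s k - l * (1 - gam ^+ k).
    by rewrite /s exprS; field; rewrite subr_eq0 gt_eqF.
  by rewrite gerBl mulr_ge0 ?(ltW l0) // subr_ge0; case/andP: (gk k).
have s0 k : 0 < s k.+1.
  by rewrite divr_gt0 ?mulr_gt0 ?subr_gt0 // exprn_ilt1 ?ltW.
have se k : s k.+1 * stepsize l gam k.+1 = 1.
  have lt1 : gam ^+ k.+1 < 1 by rewrite exprn_ilt1 ?ltW.
  rewrite /s /stepsize; field.
  by rewrite !subr_eq0 (gt_eqF l0) (gt_eqF gam1) (gt_eqF lt1).
pose a k := enorm (x k - z k) ^+ 2.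
(* One round stated before projection, so that it also covers the last round, after which no
   projection is assumed. *)
have regret k : (k <= T)%N -> f k.+1 (x k.+1) - f k.+1 (z k.+1) +
    s k.+1 / 2 * enorm (x k.+1 - stepsize l gam k.+1 *: g k.+1 (x k.+1)
       - z k.+1) ^+ 2 <=
    s k / 2 * a k.+1 + stepsize l gam k.+1 * G ^+ 2 / 2.
  move=> kT; have [Sxk Szk] := (Sx k.+1 kT, Sz k.+1 kT).
  have := gradient_step (x k.+1) (z k.+1) (s0 k) (se k) (gG k.+1 kT _ Sxk).
  have := sc k.+1 kT _ _ Sxk Szk; rewrite -opprB dotvNr -/(a _).
  have a0 : 0 <= a k.+1 by exact: sqr_ge0.
  by have := ler_wpM2r a0 (sS k); lra.
(* The potential measures the distance to the next comparator, so the drift sum runs one index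
   ahead. There are T + 1 rounds; the last is added separately, since nothing is known of
   z_(T+2). *)
have inv k : (k <= T)%N ->
  \sum_(1 <= t < k.+1) (f t (x t) - f t (z t)) + s k / 2 * a k.+1 <=
    2 * D * (l / (1 - gam)) * \sum_(2 <= t < k.+2) enorm (z t - z t.-1)
    + G ^+ 2 / 2 * \sum_(1 <= t < k.+1) stepsize l gam t.
  elim: k => [_|k IH kT].
    by rewrite !big_geq // /s expr0 subrr mulr0 !mul0r !mulr0 !addr0.
  have h0 := IH (ltnW kT); rewrite (@big_nat_recr _ _ _ k.+1) //=.
  rewrite (@big_nat_recr _ _ _ k.+2 2) //=.
  rewrite (@big_nat_recr _ _ _ k.+1 1 (stepsize l gam)) //=.
  have := regret k (ltnW kT).
  have := proj_contracts cS (xproj k.+1 kT) (Sz k.+1 (ltnW kT)).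
  have := enorm_sqr_drift (SD _ (Sx k.+2 kT)) (SD _ (Sz k.+1 (ltnW kT)))
    (SD _ (Sz k.+2 kT)).
  rewrite -/(a k.+2) => h1 h2 h3.
  have h5 := ler_wpM2l (ltW (s0 k)) (le_trans h1 (lerD h2 (lexx _))).
  have D0 : 0 <= 4 * D * enorm (z k.+2 - z k.+1).
    rewrite !mulr_ge0 ?enorm_ge0 //.
    by rewrite (le_trans (enorm_ge0 _) (SD _ (Sx k.+2 kT))).
  have h6 := ler_wpM2r D0 (sL k.+1).
  lra.
move: (inv T (leqnn _)) (regret T (leqnn _)) => h1 h2.
rewrite (@big_nat_recr _ _ _ T.+1 1) //=.
rewrite (@big_nat_recr _ _ _ T.+1 1 (stepsize l gam)) //=.
set E := enorm _ in h2.
have : 0 <= s T.+1 / 2 * E ^+ 2.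
  by rewrite mulr_ge0 ?sqr_ge0 // divr_ge0 // ltW.
lra.
Qed.

End GradientDescent.

(** * Regret of exponential weights against any single copy *)

Section Aggregation.
Context {R : realType} {n : nat}.
Variables (N : nat) (lam : R) (f : nat -> 'rV[R]_n -> R).
Variable theta : nat -> nat -> 'rV[R]_n.
Hypothesis N0 : (0 < N)%N.
Let w := weight N lam f theta.
Let mass t := \sum_(1 <= j < N.+1) w t j * expR (- lam * f t (theta j t)).

Lemma weightS t i :
  w t.+2 i = w t.+1 i * expR (- lam * f t.+1 (theta i t.+1)) / mass t.+1.
Proof. by []. Qed.

Lemma weight1_ge i : (0 < i)%N -> (i * i.+1)%:R^-1 <= w 1 i.
Proof.
move=> i0; rewrite /w /= ler_peMl ?invr_ge0 ?ler0n //.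
by rewrite lerDl divr_ge0 ?ler0n.
Qed.

Lemma sum_pos_gt0 (F : nat -> R) : (forall i, (1 <= i <= N)%N -> 0 < F i) ->
  0 < \sum_(1 <= i < N.+1) F i.
Proof.
move=> F0; rewrite big_ltn ?ltnS // ltr_wpDr ?F0 ?leqnn //=.
rewrite big_nat_cond; apply: sumr_ge0 => i; rewrite andbT => /andP[i2 iN].
by apply/ltW/F0; rewrite (ltnW i2).
Qed.

Lemma weight_gt0 t i : (1 <= i <= N)%N -> 0 < w t.+1 i.
Proof.
elim: t i => [|t IH] i iN.
  have i0 : (0 < i)%N by case/andP: iN.
  by rewrite (lt_le_trans _ (weight1_ge i0)) // invr_gt0 ltr0n muln_gt0 i0.
rewrite weightS divr_gt0 ?mulr_gt0 ?expR_gt0 ?IH //.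
by apply: sum_pos_gt0 => j jN; rewrite mulr_gt0 ?expR_gt0 ?IH.
Qed.

Lemma mass_gt0 t : 0 < mass t.+1.
Proof.
by apply: sum_pos_gt0 => j jN; rewrite mulr_gt0 ?expR_gt0 ?weight_gt0.
Qed.

(** Initially 1/(i (i+1)) telescopes to N/(N+1), which the factor 1 + 1/N cancels; later the update
    normalises. *)
Lemma sum_weight t : \sum_(1 <= i < N.+1) w t.+1 i = 1.
Proof.
case: t => [|t]; last first.
  under eq_bigr do rewrite weightS.
  by rewrite -mulr_suml divff // gt_eqF // mass_gt0.
have E k : \sum_(1 <= i < k.+1) (i * i.+1)%:R^-1 = k%:R / k.+1%:R :> R.
  elim: k => [|k IH]; first by rewrite big_geq // mul0r.
  rewrite big_nat_recr //= IH natrM -[k.+2%:R]natr1 -[k.+1%:R]natr1.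
  have k0 : 0 <= k%:R :> R by rewrite ler0n.
  by field; apply/andP; split; rewrite gt_eqF //; lra.
rewrite /w /= -mulr_sumr E -[N.+1%:R]natr1.
have n0 : 0 < N%:R :> R by rewrite ltr0n.
by field; apply/andP; split; rewrite gt_eqF //; lra.
Qed.

Lemma weight_le1 t i : (1 <= i <= N)%N -> w t.+1 i <= 1.
Proof.
move=> /andP[i1 iN]; rewrite -(sum_weight t).
rewrite (big_cat_nat i1) ?leqW //= [X in _ + X]big_ltn ?ltnS //= addrCA.
rewrite lerDl addr_ge0 // big_nat_cond;
  apply: sumr_ge0 => j /andP[/andP[j1 j2] _]; apply/ltW/weight_gt0.
  by rewrite j1 (leq_trans (ltnW j2)).
by rewrite (leq_trans i1 (ltnW j1)) -ltnS.
Qed.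

Let p := played N lam f theta.

Lemma played_in (S : set 'rV[R]_n) t : convex_set S ->
  (forall i, (1 <= i <= N)%N -> S (theta i t.+1)) -> S (p t.+1).
Proof.
move=> cS St; have := convex_set_sum cS (weight_gt0 t) St N0.
by rewrite sum_weight invr1 scale1r.
Qed.

Variables (S : set 'rV[R]_n) (l G : R) (T : nat).
Variable (g : nat -> 'rV[R]_n -> 'rV[R]_n).
Hypotheses (l0 : 0 < l) (G0 : 0 < G) (lamE : lam = l / G ^+ 2).
Hypothesis cS : convex_set S.
Hypothesis gf : forall t, (1 <= t <= T)%N -> gradient_on S (f t) (g t).
Hypothesis sc : forall t, (1 <= t <= T)%N -> strongly_convex_on S l (f t) (g t).
Hypothesis gG : forall t, (1 <= t <= T)%N ->
  forall u, S u -> enorm (g t u) <= G.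
Hypothesis Stheta : forall i t, (1 <= i <= N)%N ->
  (1 <= t <= T)%N -> S (theta i t).

(* Jensen's inequality for the concave function expR (- lam * f t). *)
Lemma mass_le t : (t < T)%N -> mass t.+1 <= expR (- lam * f t.+1 (p t.+1)).
Proof.
move=> tT; have Sp : S (p t.+1) by apply: played_in => // i iN; exact: Stheta.
set q := p t.+1 in Sp *; set E := expR _.
have qE : \sum_(1 <= j < N.+1) w t.+1 j *: theta j t.+1 = q by [].
apply: (@le_trans _ _ (\sum_(1 <= j < N.+1)
   w t.+1 j * (E * (1 - lam * dotv (g t.+1 q) (theta j t.+1 - q))))).
  rewrite /mass big_nat_cond [leRHS]big_nat_cond; apply: ler_sum => j.
  rewrite andbT ltnS => jN; rewrite (ler_wpM2l (ltW (weight_gt0 t jN))) //.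
  rewrite /E lamE; apply: (@expR_tangent _ _ S) => //.
  - exact: gf.
  - exact: sc.
  - exact: gG.
  - exact: Stheta.
(* The tangent is taken at the mean [q] itself, so its linear part averages to zero. *)
clearbody q; have -> : \sum_(1 <= j < N.+1)
   w t.+1 j * (E * (1 - lam * dotv (g t.+1 q) (theta j t.+1 - q))) =
   E * ((\sum_(1 <= j < N.+1) w t.+1 j) * (1 + lam * dotv (g t.+1 q) q)
     - lam * dotv (g t.+1 q) (\sum_(1 <= j < N.+1) w t.+1 j *: theta j t.+1)).
  rewrite dotv_sumr mulr_suml [lam * \sum_(_ <= _ < _) _]mulr_sumr -sumrB.
  rewrite [RHS]mulr_sumr; apply: eq_bigr => j _.
  by rewrite !dotvE; ring.
by rewrite sum_weight qE mul1r addrK mulr1.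
Qed.

(** By [mass_le], each round multiplies the weight of copy i by at least exp (lam times its regret
    in that round), while the weight never exceeds 1. *)
Lemma aggregation_regret i : (1 <= i <= N)%N ->
  \sum_(1 <= t < T.+1) (f t (p t) - f t (theta i t)) <= 2 * N%:R * (G ^+ 2 / l).
Proof.
move=> iN; have [i1 iN'] := andP iN.
have lam0 : 0 < lam by rewrite lamE divr_gt0 ?exprn_gt0.
have inv k : (k <= T)%N -> w 1 i *
    expR (lam * \sum_(1 <= t < k.+1) (f t (p t) - f t (theta i t))) <= w k.+1 i.
  elim: k => [_|k IH kT]; first by rewrite big_geq // mulr0 expR0 mulr1.
  rewrite big_nat_recr //= mulrDr expRD mulrA weightS.
  apply: le_trans (ler_wpM2r (expR_ge0 _) (IH (ltnW kT))) _.
  rewrite -mulrA (ler_wpM2l (ltW (weight_gt0 k iN))) //.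
  rewrite ler_pdivlMr ?mass_gt0 //.
  rewrite mulrBr -mulNr expRD mulrAC -[leRHS]mul1r mulNr -mulNr.
  rewrite ler_wpM2r ?expR_ge0 //.
  apply: le_trans (ler_wpM2l (expR_ge0 _) (mass_le kT)) _.
  by rewrite -expRD mulNr addrN expR0.
have := le_trans (inv T (leqnn _)) (weight_le1 T iN).
set A := \sum_(_ <= _ < _) _ => h.
have e1 : expR (lam * A) <= (i * i.+1)%:R.
  have i0 : 0 < (i * i.+1)%:R :> R by rewrite ltr0n muln_gt0 i1.
  rewrite -[leRHS]mul1r -ler_pdivrMr // mulrC.
  exact: le_trans (ler_wpM2r (expR_ge0 _) (weight1_ge i1)) h.
(* Crude, but a bound linear in N suffices because N will be O(ln T). *)
have e2 : (i * i.+1)%:R <= expR (2 * N%:R) :> R.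
  apply: (@le_trans _ _ ((1 + N%:R) * (1 + N%:R))).
    by rewrite nat1r -natrM ler_nat leq_mul // leqW.
  rewrite mulr_natl mulr2n expRD.
  have := expR_ge1Dx (N%:R : R) => h'.
  by apply: ler_pM => //; rewrite addr_ge0.
have : lam * A <= 2 * N%:R by rewrite -ler_expR (le_trans e1).
rewrite mulrC -ler_pdivlMr // lamE invf_div; exact.
Qed.

End Aggregation.

(** * The geometric grid of step parameters: range, size and approximation *)

Section Grid.
Context {R : realType}.
Implicit Types (D e : R) (T : nat).

Lemma ln2_ge : 1 / 2 <= ln 2 :> R.
Proof.
rewrite -ler_expR lnK ?posrE //; have := expR_ge1Dx (- (1 / 2) : R).
rewrite expRN => h; have e0 := expR_gt0 (1 / 2 : R).
have : 1 / 2 * expR (1 / 2) <= 1 :> R.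
  by rewrite -ler_pdivlMr // [leRHS]mul1r (le_trans _ h) //; lra.
lra.
Qed.

(** Lets additive constants be absorbed into multiples of ln T. *)
Lemma ln_nat_ge T : (2 <= T)%N -> 1 / 2 <= ln T%:R :> R.
Proof.
move=> T2; rewrite (le_trans ln2_ge) // ler_ln ?posrE ?ler_nat //.
by rewrite ltr0n (leq_trans _ T2).
Qed.

Lemma etaHS D T i : etaH D T i.+2 = 2 * etaH D T i.+1.
Proof. by rewrite /etaH /= exprS; ring. Qed.

Lemma ln2_gt0 : 0 < ln 2 :> R.
Proof. by rewrite (lt_le_trans _ ln2_ge). Qed.

Section Bounds.
Context (D : R) (T : nat).
Hypotheses (D1 : 1 <= D) (T2 : (2 <= T)%N).

(** Its square is the argument of the logarithm in [numH], so N = ceil (log2 r) + 1; the first grid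
    point is 1/(2 r). *)
Let r := T%:R * Num.sqrt (2 * D) / ln T%:R.

Let lnT0 : 0 < ln T%:R :> R.
Proof. by rewrite (lt_le_trans _ (ln_nat_ge T2)). Qed.

Let T0 : 0 < T%:R :> R. Proof. by rewrite ltr0n (leq_trans _ T2). Qed.

Let sqrtD1 : 1 <= Num.sqrt (2 * D).
Proof. by rewrite -[leLHS]sqrtr1 ler_wsqrtr //; have := D1; lra. Qed.

Let r1 : 1 <= r.
Proof.
rewrite /r ler_pdivlMr // mul1r (le_trans (ltW (ln_sublinear T0))) //.
by rewrite ler_peMr // ltW.
Qed.

Let numHE : numH D T = (`|Num.ceil (ln r / ln 2)| + 1)%N.
Proof.
have r0 : 0 < r := lt_le_trans ltr01 r1.
have r2 : 2 * D * T%:R ^+ 2 / ln T%:R ^+ 2 = r ^+ 2.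
  by rewrite /r !exprMn sqr_sqrtr ?exprVn; [ring|have := D1; lra].
rewrite /numH r2 lnXn // (_ : 1 / 2 * _ = ln r / ln 2) //.
by rewrite -[ln r *+ 2]mulr_natl; field; rewrite gt_eqF ?ln2_gt0.
Qed.

(** Since r >= 1 the ceiling is nonnegative, so the absolute value in [numH] changes nothing. *)
Let ceil_absz :
  `|Num.ceil (ln r / ln 2)|%N%:R = (Num.ceil (ln r / ln 2))%:~R :> R.
Proof.
rewrite natr_absz ger0_norm // ceil_ge0 (lt_le_trans (ltrN10 R)) //.
by rewrite divr_ge0 ?ln_ge0 ?ler1n.
Qed.

Let etaHE i : etaH D T i.+1 = 2 ^+ i / (2 * r).
Proof.
rewrite /etaH /r /=; field.
by rewrite !gt_eqF // (lt_le_trans _ sqrtD1).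
Qed.

Lemma etaH_gt0 i : 0 < etaH D T i.
Proof.
have s0 := lt_le_trans ltr01 sqrtD1.
by rewrite /etaH !(mulr_gt0, invr_gt0, exprn_gt0).
Qed.

Lemma etaH_le i j : (i <= j)%N -> etaH D T i <= etaH D T j.
Proof.
move=> ij; have s0 := lt_le_trans ltr01 sqrtD1.
rewrite /etaH ler_wpM2l //; last first.
  by rewrite ler_weXn2l ?ler1n // -!subn1 leq_sub2r.
by rewrite ltW // !(mulr_gt0, invr_gt0).
Qed.

(** Divided by 2 r, this places the last grid point in [1/2, 1): every gamma is positive and the
    grid reaches 1/2. *)
Let pow2_ceil : r <= 2 ^+ `|Num.ceil (ln r / ln 2)|%N < 2 * r.
Proof.
have r0 : 0 < r := lt_le_trans ltr01 r1; have l2 := ln2_gt0.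
have /andP[c1 c2] := ceil_itv (ln r / ln 2).
set c := (2 ^+ _); have c0 : 0 < c by rewrite exprn_gt0.
have lnc : ln c = (Num.ceil (ln r / ln 2))%:~R * ln 2.
  by rewrite lnXn // -[LHS]mulr_natl ceil_absz.
have rpos : r \is Num.pos by rewrite posrE.
have r2pos : 2 * r \is Num.pos by rewrite posrE mulr_gt0.
have l2r : ln (2 * r) = ln 2 + ln r by rewrite lnM ?posrE.
have cpos : c \is Num.pos by rewrite posrE.
rewrite -(ler_ln rpos cpos) -(ltr_ln cpos r2pos) l2r lnc.
rewrite -ler_pdivrMr // c2 /= -ltrBlDl.
by move: c1; rewrite ltr_pdivlMr // intrB mulrBl mul1r.
Qed.

Lemma etaH_last_lt1 : etaH D T (numH D T) < 1.
Proof.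
have r0 : 0 < r := lt_le_trans ltr01 r1.
have r20 : 0 < 2 * r by rewrite mulr_gt0.
rewrite numHE addn1 etaHE ltr_pdivrMr // mul1r.
by case/andP: pow2_ceil.
Qed.

Lemma etaH_last_ge : 1 / 2 <= etaH D T (numH D T).
Proof.
have r0 : 0 < r := lt_le_trans ltr01 r1.
have r20 : 0 < 2 * r by rewrite mulr_gt0.
rewrite numHE addn1 etaHE ler_pdivlMr //.
rewrite mulrA divfK // mul1r.
by case/andP: pow2_ceil.
Qed.

(** From r <= 4 D T and 1 / ln 2 <= 2, N is at most 2 ln (4 D) + 2 ln T + 2; the constants are
    absorbed by 1 <= 2 ln T. *)
Lemma numH_le : (numH D T)%:R <= (6 + 4 * ln (4 * D)) * ln T%:R.
Proof.
have L := ln_nat_ge T2; have r0 : 0 < r := lt_le_trans ltr01 r1.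
have D1' := D1; have D0 : 0 < 4 * D by lra.
have D4 : 0 <= ln (4 * D) by rewrite ln_ge0 //; lra.
have sD : Num.sqrt (2 * D) <= 2 * D.
  rewrite -[leRHS]mulr1 -{2}[2 * D]sqr_sqrtr; last by lra.
  by rewrite expr2 -mulrA ler_peMr ?mulr1 // ltW // (lt_le_trans _ sqrtD1).
have rle : r <= 4 * D * T%:R.
  rewrite /r ler_pdivrMr // mulrC mulrAC ler_wpM2r ?(ltW T0) //.
  have := ler_wpM2l (ltW D0) L; lra.
have lnr : ln r <= ln (4 * D) + ln T%:R.
  by rewrite -lnM ?posrE // ler_ln // posrE mulr_gt0.
have lr2 : ln r / ln 2 <= 2 * ln r.
  rewrite ler_pdivrMr ?ln2_gt0 // mulrAC ler_peMl ?ln_ge0 //.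
  by have := ln2_ge; lra.
have /andP[c1 _] := ceil_itv (ln r / ln 2).
rewrite numHE natrD ceil_absz; move: c1; rewrite intrB => c1.
have := ler_wpM2l D4 L; lra.
Qed.

(** Take the first grid point that is at least [e]: it is either the first of all, hence equal to
    [e], or twice a point below [e]. *)
Lemma grid_approx e : etaH D T 1 <= e <= 1 / 2 ->
  exists2 i, (1 <= i <= numH D T)%N & e <= etaH D T i <= 2 * e.
Proof.
move=> /andP[e1 e2].
pose Q i := (0 < i)%N && (e <= etaH D T i).
have exQ : exists i, Q i.
  exists (numH D T); rewrite /Q (le_trans e2 etaH_last_ge) andbT.
  by rewrite numHE addn1.
case: (ex_minnP exQ) => i /andP[i0 ei] imin; exists i.
  rewrite i0 imin // /Q (le_trans e2 etaH_last_ge) andbT.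
  by rewrite numHE addn1.
rewrite ei; case: i i0 ei imin => // -[_ _ _|i _ _ imin].
  by rewrite (le_trans e1) //; have := etaH_gt0 1; lra.
rewrite etaHS ler_wpM2l // ltW // ltNge; apply/negP => h.
by have := imin i.+1; rewrite /Q h ltnn => /(_ isT).
Qed.

End Bounds.
End Grid.

(** * Tuning against the best grid point and assembling the regret bound *)

Theorem theorem3p8 (R : realType) (l G D : R) (hl : 0 < l) (hG : 0 < G) (hD : 1 <= D) :
  exists K : R, forall (n : nat) (S : set 'rV[R]_n)
    (f : nat -> 'rV[R]_n -> R) (g : nat -> 'rV[R]_n -> 'rV[R]_n)
    (T : nat) (theta : nat -> nat -> 'rV[R]_n) (z : nat -> 'rV[R]_n) (V : R),
  compact S -> convex_set S ->
  (forall x, S x -> enorm x <= D) ->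
  (2 <= T)%N ->
  (forall t, (1 <= t <= T)%N ->
     gradient_on S (f t) (g t) /\ strongly_convex_on S l (f t) (g t) /\
     (forall x, S x -> enorm (g t x) <= G)) ->
  (* the N copies of projected gradient descent, gamma_i = gammaH D T i *)
  (forall i, (1 <= i <= numH D T)%N -> S (theta i 1%N)) ->
  (forall i t, (1 <= i <= numH D T)%N -> (1 <= t < T)%N ->
     is_proj S (theta i t - stepsize l (gammaH D T i) t *: g t (theta i t))
             (theta i t.+1)) ->
  (* comparator sequence *)
  (forall t, (1 <= t <= T)%N -> S (z t)) ->
  \sum_(2 <= t < T.+1) enorm (z t - z t.-1) <= V ->
  \sum_(1 <= t < T.+1)
     (f t (played (numH D T) (l / G ^+ 2) f theta t) - f t (z t))
    <= K * Num.max (ln T%:R) (Num.sqrt (T%:R * V)).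
Proof.
set s := Num.sqrt (2 * D); set B := G ^+ 2 / l.
(* The summands pay, in order, for the aggregation, the path length and the step sizes. *)
exists (2 * (6 + 4 * ln (4 * D)) * B + 4 * D * l * s + 2 * B).
move=> n S f g T theta z V _ cS SD T2 fg Stheta1 proj Sz PV.
have L : 1 / 2 <= ln T%:R :> R := ln_nat_ge T2; set lT := ln T%:R in L *.
have T0 : 0 < T%:R :> R by rewrite ltr0n (leq_trans _ T2).
have s1 : 1 <= s by rewrite -[leLHS]sqrtr1 ler_wsqrtr //; lra.
have s0 : 0 < s by rewrite (lt_le_trans _ s1).
have B0 : 0 < B by rewrite divr_gt0 ?exprn_gt0.
set P := \sum_(2 <= t < T.+1) _ in PV.
have P0 : 0 <= P by apply: sumr_ge0 => t _; exact: enorm_ge0.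
have PT : P <= 2 * D * T%:R.
  apply: (@le_trans _ _ (\sum_(2 <= t < T.+1) 2 * D)).
    rewrite /P big_nat_cond [leRHS]big_nat_cond; apply: ler_sum => t.
    rewrite andbT ltnS => /andP[t2 tT]; apply: enorm_sub_le; apply/SD/Sz.
      by rewrite (ltnW t2).
    by case: t t2 tT => // t t1 tT; rewrite -ltnS t1 ltnW.
  rewrite sumr_const_nat -[_ *+ _]mulr_natr ler_wpM2l ?mulr_ge0 //; first lra.
  by rewrite ler_nat subSS leq_subr.
(* Built from the true path length: [P] is at most 2 D T, which yields [MT], whereas [V] may be
   arbitrarily large. *)
set M := Num.max lT (Num.sqrt (T%:R * P)).
have LM : lT <= M by rewrite le_max lexx.
have M0 : 0 < M by lra.
have TPM : T%:R * P <= M ^+ 2.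
  rewrite -[leLHS]sqr_sqrtr ?mulr_ge0 ?(ltW T0) //.
  by rewrite ler_pXn2r ?nnegrE ?sqrtr_ge0 ?(ltW M0) // le_max lexx orbT.
have MT : M <= T%:R * s.
  rewrite ge_max; apply/andP; split.
    by rewrite (le_trans (ltW (ln_sublinear T0))) // ler_peMr // ltW.
  rewrite -(ler_pXn2r (ltn0Sn 1)) ?nnegrE ?sqrtr_ge0 ?mulr_ge0 ?(ltW T0)
    ?(ltW s0) //.
  rewrite sqr_sqrtr ?mulr_ge0 ?(ltW T0) // exprMn sqr_sqrtr; last lra.
  by rewrite expr2 -mulrA (ler_wpM2l (ltW T0)) // mulrC.
set e := M / (2 * T%:R * s).
have Ts0 : 0 < 2 * T%:R * s by rewrite !mulr_gt0.
have [|i iN /andP[ei ie]] := @grid_approx R D T hD T2 e.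
  (* [MT] gives e <= 1/2, and [LM] gives e >= eta_1. *)
  apply/andP; split; last first.
    by rewrite ler_pdivrMr // -!mulrA mulKf ?pnatr_eq0 // mul1r.
  have -> : etaH D T 1 = lT / (2 * T%:R * s).
    by rewrite /etaH -/lT -/s /= expr0; field; rewrite !gt_eqF.
  by rewrite ler_pM2r ?invr_gt0.
have eta0 := etaH_gt0 hD T2 i.
have eta1 : etaH D T i < 1.
  apply: le_lt_trans (etaH_last_lt1 hD T2); apply: etaH_le => //.
  by case/andP: iN.
have gam01 : 0 < gammaH D T i < 1 by rewrite /gammaH; apply/andP; split; lra.
have Sx j t : (1 <= j <= numH D T)%N -> (1 <= t <= T)%N -> S (theta j t).
  move=> jN; case: t => // -[_|t tT]; first exact: Stheta1.
  by have [] := proj j t.+1 jN tT.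
have meta : \sum_(1 <= t < T.+1)
    (f t (played (numH D T) (l / G ^+ 2) f theta t) - f t (theta i t)) <=
    2 * (numH D T)%:R * B.
  apply: (@aggregation_regret _ _ _ _ _ _ _ S l G T g) => //.
  - by rewrite /numH addn1.
  - by move=> t /fg[].
  - by move=> t /fg[_ []].
  - by move=> t /fg[_ []].
have NM : (numH D T)%:R <= (6 + 4 * ln (4 * D)) * M.
  apply: le_trans (numH_le hD T2) _; rewrite ler_wpM2l //.
  by rewrite addr_ge0 // mulr_ge0 // ln_ge0 //; lra.
have expert : \sum_(1 <= t < T.+1) (f t (theta i t) - f t (z t)) <=
    2 * D * (l / etaH D T i) * P +
    G ^+ 2 / 2 * ((1 + lT + T%:R * etaH D T i) / l).
  have e1 : 1 - gammaH D T i = etaH D T i by rewrite subKr.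
  have TE : T.-1.+1 = T by rewrite prednK // (leq_trans _ T2).
  have := @sum_stepsize_le R l _ T.-1 hl gam01; rewrite TE e1 -/lT => step.
  have := @descent_regret R n S l G D _ T.-1 f g (theta i) z hl gam01 cS SD.
  rewrite TE e1 => /(_ _ _ _ _ Sz) reg.
  apply: le_trans (reg _ _ _ _) _.
  - by move=> t /fg[_ []].
  - by move=> t /fg[_ []].
  - exact: Stheta1.
  - by move=> t; exact: proj.
  by rewrite lerD2l ler_wpM2l // divr_ge0 ?sqr_ge0.
(* The lower bound e <= eta_i controls this term through T P <= M^2; the upper bound eta_i <= 2 e
   controls the next one. *)
have PM : P / etaH D T i <= 2 * s * M.
  rewrite ler_pdivrMr // (le_trans _ (ler_wpM2l _ ei)) //; last first.
    by rewrite !mulr_ge0 // ltW.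
  rewrite -(ler_pM2l T0) (_ : T%:R * (2 * s * M * e) = M ^+ 2) //.
  by rewrite /e; field; rewrite !gt_eqF.
have TM : T%:R * etaH D T i <= M.
  apply: le_trans (ler_wpM2l (ltW T0) ie) _.
  have -> : T%:R * (2 * e) = M / s by rewrite /e; field; rewrite !gt_eqF.
  by rewrite ler_pdivrMr // ler_peMr // ltW.
set K := 2 * _ * _ + _ + _.
have K0 : 0 <= K.
  have D4 : 0 <= ln (4 * D) by rewrite ln_ge0 //; lra.
  have D4B := mulr_ge0 D4 (ltW B0).
  have Dls : 0 <= D * (l * s) by rewrite !mulr_ge0 ?(ltW hl) ?(ltW s0) //; lra.
  by rewrite /K; lra.
(* Only here does [V] replace [P], by monotonicity of the maximum. *)
apply: (@le_trans _ _ (K * M)); last first.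
  rewrite ler_wpM2l // ge_max le_max lexx /= le_max orbC ler_wsqrtr //.
  by rewrite ler_wpM2l ?(ltW T0).
have -> : \sum_(1 <= t < T.+1)
     (f t (played (numH D T) (l / G ^+ 2) f theta t) - f t (z t)) =
  \sum_(1 <= t < T.+1)
     (f t (played (numH D T) (l / G ^+ 2) f theta t) - f t (theta i t)) +
  \sum_(1 <= t < T.+1) (f t (theta i t) - f t (z t)).
  by rewrite -big_split; apply: eq_bigr => t _ /=; rewrite addrA subrK.
apply: le_trans (lerD meta expert) _.
have h1 : 2 * D * (l / etaH D T i) * P <= 2 * D * l * (2 * s * M).
  have -> : 2 * D * (l / etaH D T i) * P = 2 * D * l * (P / etaH D T i) by ring.
  by rewrite ler_wpM2l // !mulr_ge0 ?(ltW hl) //; lra.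
(* The 4 comes from 1 <= 2 lT <= 2 M, lT <= M and T eta_i <= M. *)
have h2 : G ^+ 2 / 2 * ((1 + lT + T%:R * etaH D T i) / l) <= B / 2 * (4 * M).
  have -> : G ^+ 2 / 2 * ((1 + lT + T%:R * etaH D T i) / l) =
    B / 2 * (1 + lT + T%:R * etaH D T i) by rewrite /B; ring.
  have B2 : 0 <= B / 2 by lra.
  by rewrite (ler_wpM2l B2) //; lra.
have h3 : 2 * (numH D T)%:R * B <= 2 * ((6 + 4 * ln (4 * D)) * M) * B.
  by rewrite ler_wpM2r ?(ltW B0) // ler_wpM2l.
by rewrite /K; lra.
Qed.
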